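(* Let $X$ be a Cantor set, let $G$ be a finitely generated group, and let $(X,G,\Phi,\mu)$ be a minimal equicontinuous action, where $\mu$ is its unique invariant probability measure. Suppose $(X,G,\Phi,\mu)$ is locally non-degenerate. Let $\mathrm{St}:X\to \mathrm{Sub}(G)$, $x\mapsto G_x$, let $\nu=\mathrm{St}_*\mu$, let $X_0$ be the set of points with trivial holonomy, and let $Z=\overline{\{G_x\mid x\in X_0\}}\subset \mathrm{Sub}(G)$. Then the following holds. (1) The invariant random subgroup $\nu$ is supported on $Z$. (2) The action $(X,G,\Phi,\mu)$ is not locally quasi-analytic if and only if $\nu$ is non-atomic. (3) If $(X,G,\Phi,\mu)$ is not locally quasi-analytic and the restriction $\mathrm{St}:X_0\to \mathrm{Sub}(G)$ is injective, then $\mathrm{St}$ provides a measure-theoretical isomorphism between $(X,G,\Phi,\mu)$ and $(Z,G,\nu)$, where $G$ acts on $Z$ by conjugation.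
   Context: Actions. An action $(X,G,\Phi)$ is a homomorphism $\Phi:G\to \mathrm{Homeo}(X)$, with $g\cdot x=\Phi(g)(x)$. It is minimal if every orbit is dense. It is equicontinuous if $X$ admits a compatible metric $d$ such that for all $\epsilon>0$ there is $\delta>0$ such that $d(x,y)<\delta$ implies $d(g\cdot x,g\cdot y)<\epsilon$ for all $g\in G$. A minimal equicontinuous action is uniquely ergodic, and $\mu$ denotes its unique invariant Borel probability measure. Holonomy. $G_x=\{g\in G\mid g\cdot x=x\}$ and $[G]_x=\{g\in G_x\mid g|V_g=\mathrm{id}\text{ for some open }V_g\ni x\}$. A point $x$ has trivial holonomy if $G_x=[G]_x$; $X_0=\{x\in X\mid G_x=[G]_x\}$. Locally quasi-analytic. Let $D$ be a metric on $X$ compatible with its topology. The action is locally quasi-analytic if there exists $\epsilon>0$ such that for any open $U\subset X$ with $\mathrm{diam}(U)<\epsilon$, any non-empty open $V\subset U$ and any $g_1,g_2\in G$: if $\Phi(g_1)|V=\Phi(g_2)|V$ then $\Phi(g_1)|U=\Phi(g_2)|U$. Space of subgroups. $\mathrm{Sub}(G)$ is the set of all subgroups of the discrete group $G$ with the Chabauty–Fell topology, with basic open sets $\{H\mid A\subset H,\ B\cap H=\emptyset\}$ for finite $A,B\subset G$; it is compact and totally disconnected, and $G$ acts on it by conjugation. The map $\mathrm{St}$ is Borel and equivariant. An invariant random subgroup (IRS) is a conjugation-invariant Borel probability measure on $\mathrm{Sub}(G)$; $\nu=\mathrm{St}_*\mu$ is one. ''$\nu$ is supported on $Z$'' means $\nu(\mathrm{Sub}(G)\setminus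 Z)=0$. ''Non-atomic'' means that every singleton has $\nu$-measure zero. Measure-theoretical isomorphism. Systems $(X,G,\Phi,\mu)$ and $(Y,G,\Psi,\nu)$ are isomorphic in the measure-theoretical sense if there are invariant sets of full measure $S_X\subset X$, $S_Y\subset Y$ and a bi-measurable bijection $\psi:S_X\to S_Y$ with $\mu(\psi^{-1}(A))=\nu(A)$ for all measurable $A\subset S_Y$ and $\psi(\Phi(g)(x))=\Psi(g)(\psi(x))$ for all $g\in G$, $x\in S_X$; $\psi$ is then a measure-theoretical isomorphism. In (3), $\psi$ is the restriction of $\mathrm{St}$ to an invariant set of full measure. Trees. A rooted spherically homogeneous tree $T$ with spherical index $(n_1,n_2,\ldots)$, where each $n_\ell\ge 2$ is an integer, has vertex set $V=\bigsqcup_{\ell\ge0}V_\ell$ with $|V_0|=1$; every vertex of $V_{\ell-1}$ is joined by edges to exactly $n_\ell$ vertices of $V_\ell$, and every vertex of $V_{\ell}$ is joined to exactly one vertex of $V_{\ell-1}$ ($\ell\ge 1$). The boundary $\partial T$ is the Cantor set of infinite paths $(v_\ell)_{\ell\ge0}$, $v_\ell\in V_\ell$, with consecutive vertices joined by an edge (topology induced from $\prod_\ell V_\ell$). For $v\in V$, $\partial T_v\subset\partial T$ is the clopen set of paths through $v$. The counting measure $\mu_{\partial T}$ is the Borel probability measure with $\mu_{\partial T}(\partial T_v)=1/(n_1\cdots n_\ell)$ for $v\in V_\ell$. Every $g\in \mathrm{Aut}(T)$ (root- and level-preserving automorphisms) induces a homeomorphism of $\partial T$. Locally non-degenerate. The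 action of $g\in \mathrm{Aut}(T)$ on $\partial T$ is locally non-degenerate if there exists $0<\alpha_g\le1$ such that for any vertex $v\in V$, if $g$ fixes $v$ and $g|\partial T_v\neq \mathrm{id}$, then $\mu_{\partial T}(\{\mathbf w\in\partial T_v\mid g\cdot\mathbf w\ne\mathbf w\})\ge \alpha_g\,\mu_{\partial T}(\partial T_v)$. The action of a subgroup of $\mathrm{Aut}(T)$ on $\partial T$ is locally non-degenerate if the action of each of its elements is. A minimal equicontinuous action $(X,G,\Phi,\mu)$ is locally non-degenerate if there exist a rooted spherically homogeneous tree $T$ and a homeomorphism $\phi:X\to\partial T$ such that for every $g\in G$ the map $\phi\circ\Phi(g)\circ\phi^{-1}$ is induced by an automorphism of $T$, and the resulting action of the group $\{\phi\circ\Phi(g)\circ\phi^{-1}\mid g\in G\}$ on $\partial T$ is locally non-degenerate. (Under such $\phi$, $\mu$ is pushed forward to $\mu_{\partial T}$.) *)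

(* Defs.v *)
From HB Require Import structures.
From mathcomp Require Import all_boot all_order all_algebra.
From mathcomp Require Import all_classical all_reals all_analysis.

Set Implicit Arguments.
Unset Strict Implicit.
Unset Printing Implicit Defensive.

Import Order.TTheory GRing.Theory Num.Theory.

Local Open Scope classical_set_scope.
Local Open Scope ring_scope.

Notation borel T := (g_sigma_algebraType (@open T)).

Definition homeomorphism (X Y : topologicalType) (f : X -> Y) : Prop :=
  continuous f /\
  exists h : Y -> X, [/\ continuous h, cancel f h & cancel h f].

Definition cantor_set (X : topologicalType) : Prop :=
  exists f : X -> cantor_space, homeomorphism f.

Definition compatible_metric (R : realType) (X : topologicalType)
    (d : X -> X -> R) : Prop :=
  [/\ forall x y, 0 <= d x y,
      forall x y, d x y = 0 <-> x = y,
      forall x y, d x y = d y x,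
      forall x y z, d x z <= d x y + d y z &
      forall U : set X, open U <->
        (forall x, U x -> exists2 e : R, 0 < e & [set y | d x y < e] `<=` U)].

(* The diameter of the empty set is -oo. *)
Definition diam (R : realType) (X : Type) (d : X -> X -> R) (U : set X) :
    \bar R :=
  ereal_sup [set (d p.1 p.2)%:E | p in U `*` U].

Record subgroup (G : groupType) := Subgroup {
  subgroup_set :> set G;
  subgroup1 : subgroup_set 1%g;
  subgroupM : forall g h,
    subgroup_set g -> subgroup_set h -> subgroup_set (g * h)%g;
  subgroupV : forall g, subgroup_set g -> subgroup_set (g^-1)%g
}.

Definition finitely_generated (G : groupType) : Prop :=
  exists s : seq G, forall H : subgroup G,
    {in s, forall g, subgroup_set H g} -> subgroup_set H = setT.

HB.instance Definition _ (G : groupType) := gen_eqMixin (subgroup G).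
HB.instance Definition _ (G : groupType) := gen_choiceMixin (subgroup G).

Definition trivial_subgroup (G : groupType) : subgroup G.
Proof.
exists [set 1%g] => //= [g h -> ->|g ->]; first by rewrite mulg1.
by rewrite invg1.
Defined.

HB.instance Definition _ (G : groupType) :=
  isPointed.Build (subgroup G) (trivial_subgroup G).

Section chabauty.
Variable G : groupType.

Definition chabauty_index : set (set G * set G) :=
  [set AB | finite_set AB.1 /\ finite_set AB.2].

Definition chabauty_basic (AB : set G * set G) : set (subgroup G) :=
  [set H : subgroup G | AB.1 `<=` H /\ AB.2 `&` H = set0].

Lemma chabauty_cover :
  \bigcup_(AB in chabauty_index) chabauty_basic AB = setT.
Proof.
apply/seteqP; split=> // H _; exists (set0, set0) => //=.
by split=> //=; rewrite set0I.
Qed.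

Lemma chabauty_join (i j : set G * set G) (H : subgroup G) :
  chabauty_index i -> chabauty_index j ->
  chabauty_basic i H -> chabauty_basic j H ->
  exists k, [/\ chabauty_index k, chabauty_basic k H &
    chabauty_basic k `<=` chabauty_basic i `&` chabauty_basic j].
Proof.
move=> [fi1 fi2] [fj1 fj2] [iH1 iH2] [jH1 jH2].
exists (i.1 `|` j.1, i.2 `|` j.2); split=> /=.
- by split; rewrite finite_setU.
- by split=> /=; rewrite ?setIUl ?iH2 ?jH2 ?setU0// subUset.
- move=> K [] /=; rewrite subUset => -[iK jK].
  by rewrite setIUl setU_eq0 => -[? ?].
Qed.

HB.instance Definition _ := isBaseTopological.Build (subgroup G)
  chabauty_cover chabauty_join.

End chabauty.

Definition subgroup_conj (G : groupType) (g : G) (H : subgroup G) :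
  subgroup G.
Proof.
exists [set (g * h * g^-1)%g | h in H].
- by exists 1%g; [exact: subgroup1 | rewrite mulg1 mulgV].
- move=> _ _ [h Hh <-] [k Hk <-]; exists (h * k)%g; first exact: subgroupM.
  by rewrite !mulgA mulgVK.
- move=> _ [h Hh <-]; exists (h^-1)%g; first exact: subgroupV.
  by rewrite !invgM invgK mulgA.
Defined.

Record action (G : groupType) (X : topologicalType) := Action {
  act :> G -> X -> X;
  act_homeo : forall g, homeomorphism (act g);
  actM : forall g h, act (g * h)%g = act g \o act h
}.

Lemma act1 (G : groupType) (X : topologicalType) (Phi : action G X) x :
  Phi 1%g x = x.
Proof.
have [_ [h [_ hK _]]] := act_homeo Phi 1%g.
by apply: (can_inj hK); rewrite -[LHS]/((Phi 1%g \o Phi 1%g) x) -actM mulg1.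
Qed.

(* The isotropy group G_x, as a point of Sub(G). *)
Definition stab (G : groupType) (X : topologicalType) (Phi : action G X)
  (x : X) : subgroup G.
Proof.
exists [set g | Phi g x = x] => /=.
- exact: act1.
- by move=> g h gx hx; rewrite actM /= hx.
- by move=> g gx; rewrite -{1}gx -[LHS]/((Phi _ \o Phi g) x) -actM mulVg act1.
Defined.

Section actions.
Variables (G : groupType) (X : topologicalType) (Phi : action G X).

Definition minimal_action : Prop :=
  forall x, dense [set Phi g x | g in [set: G]].

Definition equicontinuous_action (R : realType) : Prop :=
  exists2 d : X -> X -> R, compatible_metric d &
    forall eps : R, 0 < eps -> exists2 delta : R, 0 < delta &
      forall x y, d x y < delta -> forall g, d (Phi g x) (Phi g y) < eps.

(* [G]_x *)
Definition germ_stab (x : X) : set G :=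
  [set g | subgroup_set (stab Phi x) g /\
    exists V : set X, [/\ open V, V x & {in V, Phi g =1 id}]].

Definition trivial_holonomy : set X :=
  [set x | stab Phi x = germ_stab x :> set G].

Definition locally_quasi_analytic (R : realType) (D : X -> X -> R) : Prop :=
  exists2 eps : R, 0 < eps &
    forall U : set X, open U -> (diam D U < eps%:E)%E ->
    forall V : set X, open V -> V !=set0 -> V `<=` U ->
    forall g1 g2 : G, {in V, Phi g1 =1 Phi g2} -> {in U, Phi g1 =1 Phi g2}.

End actions.

Definition invariant_measure (R : realType) (G : groupType)
    (X : ptopologicalType) (Phi : action G X)
    (mu : set (borel X) -> \bar R) : Prop :=
  forall g (A : set (borel X)), measurable A -> mu (Phi g @^-1` A) = mu A.

Definition supported_on (R : realType) (T : Type) (nu : set T -> \bar R)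
    (Z : set T) : Prop :=
  nu (~` Z) = 0%E.

Definition non_atomic (R : realType) (T : Type) (nu : set T -> \bar R) : Prop :=
  forall x : T, nu [set x] = 0%E.

Definition invariant_set (G X : Type) (Phi : G -> X -> X) (S : set X) : Prop :=
  forall g x, S x -> S (Phi g x).

(* psi restricts to an isomorphism from (X, Phi, mu) to (Y, Psi, nu), where the
   phase spaces X and Y are measurable invariant subsets of S and T, with the
   induced sigma-algebras, and mu, nu are probabilities carried by X and Y. *)
Definition measure_isomorphism d d' (S : measurableType d)
    (T : measurableType d') (R : realType) (G : Type)
    (X : set S) (Phi : G -> S -> S) (mu : set S -> \bar R)
    (Y : set T) (Psi : G -> T -> T) (nu : set T -> \bar R)
    (psi : S -> T) : Prop :=
  [/\ measurable X /\ invariant_set Phi X,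
      measurable Y /\ invariant_set Psi Y &
      exists SX SY,
        [/\ [/\ measurable SX, SX `<=` X, invariant_set Phi SX & mu SX = 1%E],
            [/\ measurable SY, SY `<=` Y, invariant_set Psi SY & nu SY = 1%E],
            [/\ set_bij SX SY psi, measurable_fun SX psi &
              forall A, measurable A -> A `<=` SX -> measurable (psi @` A)],
            forall A, measurable A -> A `<=` SY ->
              mu (SX `&` psi @^-1` A) = nu A &
            forall g x, SX x -> psi (Phi g x) = Psi g (psi x)]].

(* The edges of the tree join each w in V_{l+1} to tree_parent w in V_l.
   The spherical index is shifted: tree_index l is n_{l+1}. *)
Record tree := Tree {
  tree_level : nat -> finType;
  tree_parent : forall l, tree_level l.+1 -> tree_level l;
  tree_index : nat -> nat;
  tree_index_ge2 : forall l, (2 <= tree_index l)%N;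
  tree_root : #|tree_level 0| = 1%N;
  tree_children : forall l (v : tree_level l),
    #|[set w : tree_level l.+1 | tree_parent w == v]%SET| = tree_index l
}.

Definition tree_paths (T : tree) :
    set (prod_topology (fun l => discrete_topology (tree_level T l))) :=
  [set w | forall l, tree_parent (w l.+1 : tree_level T l.+1) = w l].
Arguments tree_paths : clear implicits.

(* The boundary carries the topology induced from the product of the levels. *)
Definition boundary (T : tree) : Type := set_type (tree_paths T).

HB.instance Definition _ (T : tree) := Topological.on (boundary T).

Definition path_vertex (T : tree) (w : boundary T) (l : nat) :
  tree_level T l := set_val w l.

Section boundary_point.
Variable T : tree.

Lemma child_exists l (v : tree_level T l) :
  exists w : tree_level T l.+1, tree_parent w == v.
Proof.
have : (0 < #|[set w : tree_level T l.+1 | tree_parent w == v]%SET|)%N.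
  by rewrite tree_children (leq_trans _ (tree_index_ge2 T l)).
by case/card_gt0P => w; rewrite inE => ?; exists w.
Qed.

Lemma root_exists : exists v : tree_level T 0, true.
Proof.
have /card_gt0P[v _] : (0 < #|tree_level T 0|)%N by rewrite tree_root.
by exists v.
Qed.

Fixpoint leftmost_path (l : nat) : tree_level T l :=
  if l is l'.+1 then xchoose (child_exists (leftmost_path l'))
  else xchoose root_exists.

Lemma leftmost_pathP : leftmost_path \in tree_paths T.
Proof.
by apply/mem_set => l; exact/eqP/(xchooseP (child_exists (leftmost_path l))).
Qed.

HB.instance Definition _ :=
  isPointed.Build (boundary T) (exist _ leftmost_path leftmost_pathP).

End boundary_point.

Definition cylinder (T : tree) (l : nat) (v : tree_level T l) :
    set (boundary T) :=
  [set w | path_vertex w l = v].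

Definition counting_measure (R : realType) (T : tree)
    (m : set (borel (boundary T)) -> \bar R) : Prop :=
  forall l (v : tree_level T l),
    m (cylinder v) = ((\prod_(i < l) tree_index T i)%N%:R^-1)%:E.

Record tree_aut (T : tree) := TreeAut {
  aut_vertex : forall l, tree_level T l -> tree_level T l;
  aut_bij : forall l, bijective (@aut_vertex l);
  aut_parent : forall l (w : tree_level T l.+1),
    tree_parent (aut_vertex w) = aut_vertex (tree_parent w)
}.

Lemma aut_pathP (T : tree) (a : tree_aut T) (w : boundary T) :
  (fun l => aut_vertex a (path_vertex w l)) \in tree_paths T.
Proof.
apply/mem_set => l; rewrite /= aut_parent.
by rewrite /path_vertex (set_valP w l).
Qed.

Definition aut_boundary (T : tree) (a : tree_aut T) (w : boundary T) :
  boundary T := exist (fun u => u \in tree_paths T) _ (aut_pathP a w).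

Definition locally_non_degenerate_aut (R : realType) (T : tree)
    (m : set (borel (boundary T)) -> \bar R) (a : tree_aut T) : Prop :=
  exists alpha : R, [/\ 0 < alpha, alpha <= 1 &
    forall l (v : tree_level T l), aut_vertex a v = v ->
      ~ {in cylinder v, aut_boundary a =1 id} ->
      (alpha%:E * m (cylinder v) <=
        m [set w | cylinder v w /\ aut_boundary a w <> w])%E].

(* m is the (unique) counting measure on the boundary of T. An automorphism is
   determined by its action on the boundary, so the choice of a is harmless. *)
Definition locally_non_degenerate (R : realType) (G : groupType)
    (X : topologicalType) (Phi : action G X) : Prop :=
  exists (T : tree) (phi : X -> boundary T)
      (m : probability (borel (boundary T)) R),
    [/\ homeomorphism phi, counting_measure m &
      forall g, exists2 a : tree_aut T,
        (forall x, phi (Phi g x) = aut_boundary a (phi x)) &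
        locally_non_degenerate_aut m a].

(* Main.v *)
Require Import Defs.
From HB Require Import structures.
From mathcomp Require Import all_boot all_order all_algebra lra.
From mathcomp Require Import all_classical all_reals all_analysis.

(** The tree structure enters through the clopen partitions of [X] into level
    sets. A minimal action permutes the level sets of a given level
    transitively, so the invariant measure gives them the same mass as the
    counting measure. Let [B] be the set of fixed points of [g] at which [g]
    is not locally trivial. Near a point of [B], local non-degeneracy says that
    [g] moves at least a proportion [alpha] of every level set; the saturations
    of the closed set [B] decrease to [B] while their moved parts decrease to
    the empty set, so [alpha * mu B <= 0]. Hence almost every point has trivial
    holonomy, and (1) follows.

    (2) If the action is locally quasi-analytic, the stabilizer is constant on
    the trivial-holonomy points of a small ball. Conversely, the conjugates of
    an atom [H] have equal mass, so there are finitely many of them, and since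
    orbits are dense one of them is the stabilizer of a dense set of points of
    some non-empty open set [W]; every [g] trivial on an open subset of [W] is
    then trivial on [W]. A Lebesgue number of the cover by translates of [W]
    gives quasi-analyticity.

    (3) The stabilizer map is continuous at the points of trivial holonomy, and
    these contain an invariant countable union of compact sets of full measure,
    on which an injective stabilizer map has measurable images. *)

Set Implicit Arguments.
Unset Strict Implicit.
Unset Printing Implicit Defensive.

Import Order.TTheory GRing.Theory Num.Theory.

Local Open Scope classical_set_scope.
Local Open Scope ring_scope.

(** * The space of subgroups of a finitely generated group *)

Section countable_group.
Variables (G : groupType) (s : seq G).

(** The letter [(b, n)] is the generator of index [n], inverted when [b] is true. Indices beyond [s]
    read the default [1], so words range over a plain countable type. *)
Definition word (w : seq (bool * nat)) : G :=
  foldr (fun x a => (if x.1 then (nth 1 s x.2)^-1 else nth 1 s x.2) * a)%g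
    1%g w.

Lemma word_cat u v : word (u ++ v) = (word u * word v)%g.
Proof. by elim: u => [|x u /= ->]; rewrite ?mul1g ?mulgA. Qed.

Lemma word_inv u : exists v, word v = (word u)^-1%g.
Proof.
elim: u => [|[b n] u [v vE]]; first by exists [::]; rewrite /= invg1.
exists (v ++ [:: (~~ b, n)]); rewrite word_cat vE /= mulg1 invgM.
by case: b => //=; rewrite invgK.
Qed.

Definition word_subgroup : subgroup G.
Proof.
exists (range word).
- by exists [::].
- by move=> _ _ [u _ <-] [v _ <-]; exists (u ++ v); rewrite ?word_cat.
- by move=> _ [u _ <-]; have [v vE] := word_inv u; exists v.
Defined.

End countable_group.

(** By finite generation the subgroup of all words is [G], and [pickle] codes words by integers. *)
Lemma finitely_generated_countable (G : groupType) :
  finitely_generated G -> exists e : nat -> G, forall g, exists n, e n = g.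
Proof.
move=> [s /(_ (word_subgroup s)) sG].
exists (fun n => if unpickle n is Some w then word s w else 1%g).
move=> g; have : subgroup_set (word_subgroup s) g.
  rewrite sG// => h hs; exists [:: (false, index h s)] => //=.
  by rewrite mulg1 nth_index.
by move=> [w _ <-]; exists (pickle w); rewrite pickleK.
Qed.

Section chabauty_topology.
Variable G : groupType.
Implicit Types (H K : subgroup G) (g : G).

Lemma subgroup_eq H K : (H : set G) = K -> H = K.
Proof.
case: H K => [H H1 HM HV] [K K1 KM KV] /= HK; subst K.
by congr Subgroup; exact: Prop_irrelevance.
Qed.

Lemma open_chabauty_basic (AB : set G * set G) :
  chabauty_index AB -> open (chabauty_basic AB).
Proof.
move=> iAB; exists [set AB]; first by move=> _ ->.
by rewrite bigcup_set1.
Qed.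

Lemma open_subgroup_mem g : open [set H : subgroup G | subgroup_set H g].
Proof.
have := @open_chabauty_basic ([set g], set0).
rewrite /chabauty_basic /=.
rewrite (_ : [set _ | _] = [set H : subgroup G | subgroup_set H g]).
  by apply; split => /=; [exact: finite_set1|exact: finite_set0].
by apply/seteqP; split => H /=; rewrite set0I sub1set inE// => -[].
Qed.

Lemma open_subgroup_nmem g : open [set H : subgroup G | ~ subgroup_set H g].
Proof.
have := @open_chabauty_basic (set0, [set g]).
rewrite /chabauty_basic /=.
rewrite (_ : [set _ | _] = [set H : subgroup G | ~ subgroup_set H g]).
  by apply; split => /=; [exact: finite_set0|exact: finite_set1].
apply/seteqP; split => H /=; first by move=> [_ /seteqP[+ _]] Hg; apply; split.
by move=> Hg; split => //; apply/seteqP; split => // h [/= ->].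
Qed.

(** A basic open set tests only finitely many elements of [G], so convergence can be checked one
    element at a time. *)
Lemma cvg_subgroup (F : set_system (subgroup G)) {FF : Filter F} H :
  (forall g, \forall K \near F, subgroup_set K g <-> subgroup_set H g) ->
  F --> H.
Proof.
move=> FH A; rewrite nbhsE => -[_ [[D DI <-] [[B C] D_BC [BH CH]]] BCA].
have [finB finC] := DI _ D_BC.
have near_all (E : set G) : finite_set E ->
    \forall K \near F, forall g, E g -> (subgroup_set K g <-> subgroup_set H g).
  move=> /finite_seqP[s ->]; elim: s => [|g s IH]; first exact: nearW.
  apply: filterS2 (FH g) IH => K Kg Ks h /=.
  by rewrite inE => /orP[/eqP ->//|/Ks].
apply: filterS2 (near_all _ finB) (near_all _ finC) => K KB KC.
apply: BCA; exists (B, C) => //; split => /= [g Bg|]; first exact/KB/BH.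
apply/seteqP; split => // g [Cg /(KC _ Cg) Hg].
by rewrite -[set0]CH.
Qed.

Lemma subgroup_hausdorff : hausdorff_space (subgroup G).
Proof.
move=> H K HK; apply: subgroup_eq; apply/seteqP; split => g Hg.
- apply: contrapT => Kg.
  have [L []//] := HK _ _ (open_nbhs_nbhs (conj (@open_subgroup_mem g) Hg))
    (open_nbhs_nbhs (conj (@open_subgroup_nmem g) Kg)).
- apply: contrapT => Kg.
  have [L []//] := HK _ _ (open_nbhs_nbhs (conj (@open_subgroup_nmem g) Kg))
    (open_nbhs_nbhs (conj (@open_subgroup_mem g) Hg)).
Qed.

Lemma subgroup_conjE g H k :
  subgroup_set (subgroup_conj g H) k <-> subgroup_set H (g^-1 * k * g)%g.
Proof.
split=> [[h Hh <-]|Hk]; first by rewrite !mulgA mulVg mul1g -mulgA mulVg mulg1.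
by exists (g^-1 * k * g)%g => //; rewrite !mulgA mulgV mul1g -mulgA mulgV mulg1.
Qed.

Lemma subgroup_conj_continuous g : continuous (@subgroup_conj G g).
Proof.
move=> H; apply: cvg_subgroup => [|k].
  by apply: fmap_filter; exact: nbhs_filter.
have [Hk|Hk] := pselect (subgroup_set H (g^-1 * k * g)%g).
- have := open_nbhs_nbhs (conj (@open_subgroup_mem (g^-1 * k * g)%g) Hk).
  by rewrite near_map; apply: filterS => K Kk; split=> _; exact/subgroup_conjE.
- have := open_nbhs_nbhs (conj (@open_subgroup_nmem (g^-1 * k * g)%g) Hk).
  by rewrite near_map; apply: filterS => K Kk; split=> /subgroup_conjE.
Qed.

(** This is second countability: pairs of finite sequences of indices form a countable type, so
    Borel measurability reduces to membership of single elements. *)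
Lemma open_subgroup_countable (e : nat -> G) (U : set (subgroup G)) :
  (forall g, exists n, e n = g) -> open U ->
  exists D : set (seq nat * seq nat), U = \bigcup_(st in D)
    [set H : subgroup G | (forall n, n \in st.1 -> subgroup_set H (e n)) /\
                          (forall n, n \in st.2 -> ~ subgroup_set H (e n))].
Proof.
move=> /choice[f ef] oU.
pose B (st : seq nat * seq nat) : set (subgroup G) :=
  [set H | (forall n, n \in st.1 -> subgroup_set H (e n)) /\
           (forall n, n \in st.2 -> ~ subgroup_set H (e n))].
exists [set st | B st `<=` U].
apply/seteqP; split => [H UH|H [st stU]]; last first.
  exact: stU.
have : nbhs H U by exact: open_nbhs_nbhs.
rewrite nbhsE => -[_ [[D DI <-] [[A C] D_AC [AH CH]]] ACU].
have [/finite_seqP[s sA] /finite_seqP[t tC]] := DI _ D_AC.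
simpl in *.
exists (map f s, map f t) => /=.
- move=> K [/= Ks Kt]; apply: ACU; exists (A, C) => //; split => /=.
    by rewrite sA => g gs; rewrite -(ef g); apply: Ks; rewrite map_f.
  apply/seteqP; split => // g []; rewrite tC /= => gt.
  by rewrite -{1}(ef g); apply: Kt; rewrite map_f.
- split => _ /mapP[g gs ->]; rewrite ef.
    by apply: AH; rewrite sA.
  by move=> Hg; rewrite -[False]/(set0 g) -CH; split=> //; rewrite tC.
Qed.

End chabauty_topology.

(** * Stabilizers and holonomy *)

Section homeomorphic_to_compact_hausdorff.
Variables (X Y : topologicalType) (f : X -> Y).
Hypothesis hf : homeomorphism f.

Lemma homeomorphism_hausdorff : hausdorff_space Y -> hausdorff_space X.
Proof.
case: hf => cf [h [_ fK _]] hY x y xy; apply: (can_inj fK); apply: hY.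
move=> A B /cf fA /cf fB; have [z [zA zB]] := xy _ _ fA fB.
by exists (f z).
Qed.

Lemma homeomorphism_compact : compact [set: Y] -> compact [set: X].
Proof.
case: hf => cf [h [ch fK _]] /(@continuous_compact _ _ h) => hY.
rewrite (_ : [set: X] = h @` setT); first by apply/hY/continuous_subspaceT.
by apply/seteqP; split => // x _; exists (f x).
Qed.

End homeomorphic_to_compact_hausdorff.

Section action_lemmas.
Variables (G : groupType) (X : topologicalType) (Phi : action G X).
Implicit Types (x y : X) (g h : G).

Lemma act_continuous g : continuous (Phi g).
Proof. by have [] := act_homeo Phi g. Qed.

Lemma act_mul g h x : Phi (g * h)%g x = Phi g (Phi h x).
Proof. by rewrite actM. Qed.

Lemma actK g : cancel (Phi g) (Phi g^-1%g).
Proof. by move=> x; rewrite -act_mul mulVg act1. Qed.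

Lemma actVK g : cancel (Phi g^-1%g) (Phi g).
Proof. by move=> x; rewrite -act_mul mulgV act1. Qed.

Lemma act_preimage g (A : set X) : Phi g @^-1` A = Phi g^-1%g @` A.
Proof.
apply/seteqP; split => [x Ax|_ [x Ax <-]] /=; last by rewrite actVK.
by exists (Phi g x); rewrite ?actK.
Qed.

Lemma open_act g (A : set X) : open A -> open (Phi g @` A).
Proof.
move=> oA; rewrite -[g]invgK -act_preimage.
by apply: open_comp => // x _; exact: act_continuous.
Qed.

Lemma stab_act g x : stab Phi (Phi g x) = subgroup_conj g (stab Phi x).
Proof.
apply: subgroup_eq; apply/seteqP; split => k.
- move=> kgx; apply/subgroup_conjE => /=.
  by rewrite !act_mul kgx actK.
- by move=> /subgroup_conjE /= kx; rewrite -{2}kx !act_mul actVK.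
Qed.

Definition fixed_points g : set X := [set x | Phi g x = x].

(** The points at which [g] witnesses nontrivial holonomy. In a Hausdorff space this is the
    topological boundary of the fixed-point set. *)
Definition nondegenerate_fixed_points g : set X :=
  fixed_points g `\` (fixed_points g)°.

Lemma trivial_holonomyP x : trivial_holonomy Phi x <->
  forall g, Phi g x = x -> (fixed_points g)° x.
Proof.
split => [x0 g gx|x0].
- have : germ_stab Phi x g by rewrite -x0.
  move=> [_ [V [oV Vx Vg]]]; rewrite /interior.
  have := open_nbhs_nbhs (conj oV Vx); apply: filterS => y Vy.
  by apply: Vg; rewrite inE.
- apply/seteqP; split => g; last by case.
  move=> gx; split => //; exists (fixed_points g)°.
  by split; [exact: open_interior|exact: x0|move=> y /set_mem/interior_subset].
Qed.

Lemma nontrivial_holonomyE :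
  ~` trivial_holonomy Phi = \bigcup_g nondegenerate_fixed_points g.
Proof.
apply/seteqP; split => x /=.
- apply: contra_notP => nx; apply/trivial_holonomyP => g gx.
  by apply: contrapT => ngx; apply: nx; exists g.
- by move=> [g _ [gx ngx]] /trivial_holonomyP /(_ g gx).
Qed.

Lemma trivial_holonomy_act g x :
  trivial_holonomy Phi x -> trivial_holonomy Phi (Phi g x).
Proof.
move=> /trivial_holonomyP x0; apply/trivial_holonomyP => k kgx.
have /x0 : Phi (g^-1 * k * g)%g x = x by rewrite !act_mul kgx actK.
(* With [x] seen as the image of [Phi g x] under [g^-1], continuity of [g^-1] turns a neighbourhood
   of [x] into one of [Phi g x]. *)
rewrite -{1}[x](actK g) /interior => /act_continuous.
rewrite /nbhs /=; apply: filterS => y /=; rewrite /fixed_points /= !act_mul.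
by rewrite actVK => /(congr1 (Phi g)); rewrite !actVK.
Qed.

Hypothesis hX : hausdorff_space X.

Lemma closed_fixed_points g : closed (fixed_points g).
Proof.
rewrite -[X in closed X]setCK; apply: open_closedC.
rewrite openE => x /= /eqP gx.
move: hX; rewrite open_hausdorff => /(_ _ _ gx).
move=> [[A B] /= [/set_mem gxA /set_mem xB] [oA oB /eqP AB]]; rewrite /interior.
have nA : \forall y \near x, A (Phi g y).
  by apply: act_continuous; exact: open_nbhs_nbhs.
apply: filterS2 nA (open_nbhs_nbhs (conj oB xB)) => y /= Ay By gy.
by rewrite -[False]/(set0 y) -AB; split => //; rewrite -gy.
Qed.

Lemma closed_nondegenerate_fixed_points g :
  closed (nondegenerate_fixed_points g).
Proof.
apply: closedI; first exact: closed_fixed_points.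
by apply: open_closedC; exact: open_interior.
Qed.

(** Membership of each [g] in the stabilizer is constant near [x]: by trivial holonomy if [g] fixes
    [x], by closedness of the fixed-point set if not. *)
Lemma stab_continuous x : trivial_holonomy Phi x ->
  {for x, continuous (stab Phi)}.
Proof.
move=> /trivial_holonomyP x0; apply: cvg_subgroup => g; rewrite near_map.
have [gx|gx] := pselect (Phi g x = x).
- by have := x0 _ gx; apply: filterS => y gy; split.
- have oF := closed_openC (@closed_fixed_points g).
  by have := open_nbhs_nbhs (conj oF gx); apply: filterS => y gy; split.
Qed.

End action_lemmas.

(** * Measures and towers of clopen partitions *)

Lemma open_measurable_borel (X : ptopologicalType) (U : set (borel X)) :
  @open X U -> measurable U.
Proof. exact: sub_sigma_algebra. Qed.

Lemma closed_measurable_borel (X : ptopologicalType) (F : set (borel X)) :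
  @closed X F -> measurable F.
Proof.
move=> cF; rewrite -[F]setCK; apply: measurableC.
by apply: open_measurable_borel; exact: closed_openC.
Qed.

(** This retains what the tree says about the topology of [X]: successively finer finite clopen
    partitions whose cells generate the neighbourhoods of each point. *)
Record fibre_tower (X : topologicalType) (V : nat -> finType)
    (p : forall l, X -> V l) : Prop := FibreTower {
  fibre_open : forall l v, open (p l @^-1` [set v]);
  fibre_refine : forall l x y, p l.+1 x = p l.+1 y -> p l x = p l y;
  fibre_nbhs : forall x U, nbhs x U ->
    exists l, [set y | p l y = p l x] `<=` U
}.

Section tower_measure.
Variables (R : realType) (X : ptopologicalType) (V : nat -> finType).
Variables (p : forall l, X -> V l) (hp : fibre_tower p).
Implicit Types (F : set X) (m : probability (borel X) R).

Definition saturation l F : set (borel X) := p l @^-1` (p l @` F).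

Lemma open_level l (A : set (V l)) : open (p l @^-1` A).
Proof.
rewrite -[A]image_id -bigcup_imset1 preimage_bigcup.
by apply: bigcup_open => v _; exact: fibre_open.
Qed.

Lemma measurable_level l (A : set (V l)) :
  measurable (p l @^-1` A : set (borel X)).
Proof. by apply: open_measurable_borel; exact: open_level. Qed.

Lemma saturation_sub l F : F `<=` saturation l F.
Proof. by move=> x Fx; exists x. Qed.

Lemma saturation_nonincreasing F :
  {homo saturation^~ F : n k / (n <= k)%N >-> (k <= n)%O}.
Proof.
move=> n k nk; rewrite subsetEset.
elim: k nk => [|k IH]; first by rewrite leqn0 => /eqP ->.
rewrite leq_eqVlt => /predU1P[->//|]; rewrite ltnS => /IH; apply: subset_trans.
by move=> x [y Fy /(fibre_refine hp)]; exists y.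
Qed.

Lemma bigcap_saturation F : closed F -> \bigcap_l saturation l F = F.
Proof.
move=> cF; apply/seteqP; split => [x Fx|x Fx l _]; last exact: saturation_sub.
apply: contrapT => nFx.
have [l lF] := fibre_nbhs hp (open_nbhs_nbhs (conj (closed_openC cF) nFx)).
have [y Fy /lF] := Fx l I; exact.
Qed.

(** The saturations of a closed set decrease to it, so this is continuity from above; [B] allows
    only the moved part of each saturation to be followed. *)
Lemma cvg_saturation m F (B : set (borel X)) : closed F -> measurable B ->
  m (saturation l F `&` B) @[l --> \oo] --> m (F `&` B).
Proof.
move=> cF mB; rewrite -{2}(bigcap_saturation cF).
rewrite (_ : _ `&` B = \bigcap_l (saturation l F `&` B)); last first.
  by rewrite bigcapIl//; exists 0%N.
have mS l : measurable (saturation l F `&` B).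
  by apply: measurableI => //; exact: measurable_level.
apply: nonincreasing_cvg_mu => //.
- by rewrite (le_lt_trans (probability_le1 _ _)) ?ltry.
- exact: bigcap_measurable.
- move=> n k nk; rewrite subsetEset; apply: setSI.
  by rewrite -subsetEset; exact: saturation_nonincreasing.
Qed.

Lemma measure_level m l (A : set (V l)) (B : set (borel X)) : measurable B ->
  m (p l @^-1` A `&` B) = (\sum_(v \in A) m (p l @^-1` [set v] `&` B))%E.
Proof.
move=> mB; rewrite -measure_fin_bigcup//.
- congr (m _); apply/seteqP; split => [x [Ax Bx]|x [v Av [/= vE Bx]]].
    by exists (p l x).
  by split => //=; rewrite vE.
- exact: finite_finset.
- by move=> v w _ _ [x [[/= <- _] [/= <- _]]].
- by move=> v _; apply: measurableI => //; exact: measurable_level.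
Qed.

(** Each saturation is a finite disjoint union of level sets, where the measures agree; the limit
    gives [F]. *)
Lemma eq_measure_closed m1 m2 F :
  (forall l v, m1 (p l @^-1` [set v]) = m2 (p l @^-1` [set v])) ->
  closed F -> m1 F = m2 F.
Proof.
move=> m12 cF; rewrite -[F]setIT.
rewrite -(cvg_lim _ (cvg_saturation (m := m1) cF measurableT))//.
rewrite -(cvg_lim _ (cvg_saturation (m := m2) cF measurableT))//.
have -> : (fun l => m1 (saturation l F `&` setT)) =
          (fun l => m2 (saturation l F `&` setT)).
  apply/funext => l; rewrite !measure_level//.
  by apply: eq_fsbigr => v _; rewrite !setIT.
by [].
Qed.

(* The mass of O inside the level saturations of F tends to m (F `&` O) = 0,
   while it is at least alpha * m F. *)
Lemma nonporous_null m (alpha : R) F (O : set (borel X)) : 0 < alpha ->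
  closed F -> measurable O -> F `&` O = set0 ->
  (forall l x, F x -> (alpha%:E * m (p l @^-1` [set p l x]) <=
                       m (p l @^-1` [set p l x] `&` O))%E) ->
  m F = 0%E.
Proof.
move=> alpha0 cF mO FO hF.
have leF l : (alpha%:E * m F <= m (saturation l F `&` O))%E.
  rewrite (@le_trans _ _ (alpha%:E * m (saturation l F `&` setT))%E)//.
    rewrite lee_pmul2l ?lte_fin// setIT le_measure ?inE//.
    - exact: closed_measurable_borel.
    - exact: measurable_level.
    - exact: saturation_sub.
  rewrite !measure_level// ge0_mule_fsumr//.
  apply: lee_fsum => [|_ [x Fx <-]]; first exact: finite_finset.
  by rewrite setIT; exact: hF.
have : (alpha%:E * m F <= m (F `&` O))%E.
  by apply: (cvge_ge _ (cvg_saturation (m := m) cF mO)); exact: nearW.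
rewrite FO measure0 -[leRHS](mule0 alpha%:E) lee_pmul2l ?lte_fin// => mF0.
by apply/eqP; rewrite -measure_le0.
Qed.

(** A saturation of high level serves as [U]: it is open and its mass tends to that of [F]. *)
Lemma null_closed_outer m F (e : R) : 0 < e -> closed F -> m F = 0%E ->
  exists U, [/\ open U, F `<=` U & (m U <= e%:E)%E].
Proof.
move=> e0 cF F0.
have := cvg_saturation (m := m) cF measurableT; rewrite setIT F0 => h.
have /h[l _ /(_ l (leqnn l)) /=] : nbhs 0%E [set y | (y < e%:E)%E].
  apply: open_nbhs_nbhs; split; first exact: open_ereal_lt_ereal.
  by rewrite /= lte_fin.
rewrite setIT => le; exists (saturation l F); split; last exact: ltW.
- exact: open_level.
- exact: saturation_sub.
Qed.

End tower_measure.

(** * The boundary of a tree as a tower of partitions *)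

Section boundary_topology.
Variable T : tree.
Implicit Types (w : boundary T).

Lemma path_vertex_parent w l :
  tree_parent (path_vertex w l.+1) = path_vertex w l.
Proof. exact: (set_valP w l). Qed.

Lemma path_vertex_le w w' k l : (k <= l)%N ->
  path_vertex w l = path_vertex w' l -> path_vertex w k = path_vertex w' k.
Proof.
elim: l => [|l IH]; first by rewrite leqn0 => /eqP ->.
rewrite leq_eqVlt => /predU1P[->//|]; rewrite ltnS => kl ww'; apply: IH => //.
by rewrite -path_vertex_parent ww' path_vertex_parent.
Qed.

Lemma open_cylinder l (v : tree_level T l) : open (cylinder v).
Proof.
exists (proj l @^-1` [set v]) => //; apply: open_comp => [w _|].
  exact: proj_continuous.
exact: discrete_open.
Qed.

Lemma nbhs_cylinder w U : nbhs w U ->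
  exists l, [set w' | path_vertex w' l = path_vertex w l] `<=` U.
Proof.
(* The filter generated by the cylinders around [w] converges to [w] in the product topology,
   because coordinate [i] is constant on cylinders of level [i]. *)
pose F := filter_from [set: nat]
  (fun l => [set w' | path_vertex w' l = path_vertex w l]).
have FF : Filter F.
  apply: filter_from_filter; first by exists 0%N.
  move=> i j _ _; exists (maxn i j) => // w' ww'.
  by split; apply: path_vertex_le ww'; rewrite ?leq_maxl ?leq_maxr.
suff Fw : set_val @ F --> set_val w.
  rewrite nbhsE => -[_ [[B oB <-] Bw] BU].
  have [l _ lB] := Fw _ (open_nbhs_nbhs (conj oB Bw)).
  by exists l => w' /lB; exact: BU.
apply/cvg_sup => i A; rewrite nbhsE => -[_ [[B oB <-] Bw] BA].
exists i => // w' /= ww'; apply: BA => /=.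
by move: Bw; rewrite /path_vertex in ww' *; rewrite /= ww'.
Qed.

End boundary_topology.

Section tree_tower.
Variables (X : topologicalType) (T : tree) (phi : X -> boundary T).
Hypothesis hphi : homeomorphism phi.

Lemma tree_tower : fibre_tower (fun l x => path_vertex (phi x) l).
Proof.
have [cphi [psi [cpsi phiK psiK]]] := hphi; split.
- move=> l v; rewrite (_ : _ @^-1` _ = phi @^-1` (cylinder v)) //.
  by apply: open_comp => [x _|]; [exact: cphi|exact: open_cylinder].
- by move=> l x y xy; rewrite -path_vertex_parent xy path_vertex_parent.
- move=> x U xU; have : nbhs (phi x) (psi @^-1` U).
    by apply: cpsi; rewrite phiK.
  move=> /nbhs_cylinder[l lU]; exists l => y /lU.
  by rewrite /= phiK.
Qed.

End tree_tower.

Lemma continuous_measurable_borel (X Y : ptopologicalType)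
    (f : X -> Y) :
  continuous f -> measurable_fun setT (f : borel X -> borel Y).
Proof.
move=> cf; apply: (measurability (rT := borel Y) (@open Y)) => //.
move=> _ [B oB <-]; rewrite setTI; apply: open_measurable_borel.
by apply: open_comp => // x _; exact: cf.
Qed.

Lemma image_probability (R : realType) (X Y : ptopologicalType)
    (f : X -> Y) (m : probability (borel X) R) :
  continuous f ->
  exists m' : probability (borel Y) R, forall A, m' A = m (f @^-1` A).
Proof.
move=> cf; have mf := continuous_measurable_borel cf.
pose bf : borel X -> borel Y := f.
pose F : {mfun borel X >-> borel Y} :=
  HB.pack bf (isMeasurableFun.Build _ _ _ _ bf mf).
by exists (distribution m F).
Qed.

Lemma fsumEFin_const (R : realType) (T : choiceType) (A : set T) (a : R) :
  finite_set A ->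
  (\sum_(v \in A) a%:E = (a *+ size (finmap.enum_fset (fset_set A)))%:E)%E.
Proof.
move=> fA; rewrite fsbig_finite// sumEFin big_const_seq count_predT.
by rewrite iter_addr_0.
Qed.

(** * Equidistribution on level sets and local non-degeneracy *)

Section equidistribution.
Variables (R : realType) (X : ptopologicalType) (G : groupType).
Variables (Phi : action G X) (V : nat -> finType) (p : forall l, X -> V l).
Hypothesis hp : fibre_tower p.
Hypothesis act_level : forall g l x y,
  p l x = p l y -> p l (Phi g x) = p l (Phi g y).
Variables (mu m : probability (borel X) R) (c : nat -> R).
Hypotheses (hmin : minimal_action Phi) (hmu : invariant_measure Phi mu).
Hypothesis c_gt0 : forall l, 0 < c l.
Hypothesis hm : forall l (v : V l), m (p l @^-1` [set v]) = (c l)%:E.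

Lemma level_surjective l (v : V l) : exists x, p l x = v.
Proof.
apply: contrapT => /forallNP v0; have := c_gt0 l.
rewrite -lte_fin -(hm v) (_ : _ @^-1` _ = set0) ?measure0 ?ltxx//.
by apply/seteqP; split => x // /v0.
Qed.

(** By minimality some [g] sends a point of the first level set into the second; since [g] respects
    levels, the whole level set follows, and [mu] is invariant. *)
Lemma invariant_level_le l (v w : V l) :
  (mu (p l @^-1` [set v]) <= mu (p l @^-1` [set w]))%E.
Proof.
have [x xv] := level_surjective v; have [y yw] := level_surjective w.
have [z' [/= zw [g _ gx]]] :
    p l @^-1` [set w] `&` [set Phi g x | g in setT] !=set0.
  by apply: hmin; [exists y|exact: fibre_open].
rewrite -(@hmu g (p l @^-1` [set w]) (measurable_level hp [set w])).
apply: le_measure; rewrite ?inE.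
- exact: measurable_level.
- apply: open_measurable_borel; apply: open_comp; last exact: fibre_open.
  by move=> z _; exact: act_continuous.
- by move=> z /= zv; rewrite -zw -gx; apply: act_level; rewrite zv.
Qed.

(** Each measure divides the mass [1] equally among the level sets of level [l]; their number is
    nonzero because [v] exists, so the two shares coincide. *)
Lemma invariant_level l (v : V l) :
  mu (p l @^-1` [set v]) = m (p l @^-1` [set v]).
Proof.
have muE w : mu (p l @^-1` [set w]) = (fine (mu (p l @^-1` [set v])))%:E.
  rewrite fineK; last first.
    by apply: fin_num_measure; exact: measurable_level.
  by apply/eqP; rewrite eq_le !invariant_level_le.
have fV := @finite_finset _ [set: V l].
have total (m' : probability (borel X) R) (a : R) :
    (forall w : V l, m' (p l @^-1` [set w]) = a%:E) ->
    1%E = (a *+ size (finmap.enum_fset (fset_set [set: V l])))%:E.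
  move=> m'a; rewrite -(probability_setT m') -fsumEFin_const//.
  rewrite -[X in m' X]setIT -[X in m' (X `&` _)](preimage_setT (p l)).
  by rewrite measure_level//; apply: eq_fsbigr => w _; rewrite setIT m'a.
have : (c l *+ size (finmap.enum_fset (fset_set [set: V l])))%:E =
    (fine (mu (p l @^-1` [set v])) *+
     size (finmap.enum_fset (fset_set [set: V l])))%:E.
  by rewrite -(total _ _ muE) -(total _ _ (@hm l)).
move=> [/eqP].
rewrite -subr_eq0 -mulrnBl mulrn_eq0 subr_eq0 => /orP[|/eqP cE].
  rewrite finmap.cardfs_eq0 => /eqP V0.
  by have := in_fset_set fV v; rewrite V0 finmap.in_fset0 in_setT.
by rewrite hm muE cE.
Qed.

End equidistribution.

(** The counting measure, carried back to [X], agrees with [mu] on level sets and hence on closed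
    sets, so [nonporous_null] can be applied to it, with [O] the set of points moved by [g]. *)
Lemma locally_non_degenerate_null (R : realType) (X : ptopologicalType)
    (G : groupType) (Phi : action G X) (mu : probability (borel X) R) :
  hausdorff_space X -> minimal_action Phi -> invariant_measure Phi mu ->
  locally_non_degenerate R Phi ->
  exists (V : nat -> finType) (p : forall l, X -> V l),
    [/\ fibre_tower p,
        forall g, mu (nondegenerate_fixed_points Phi g) = 0%E &
        forall U : set X, open U -> U !=set0 -> (0 < mu U)%E].
Proof.
move=> hX hmin hmu [T [phi [m [hphi hm hnd]]]].
pose p l x := path_vertex (phi x) l.
have hp : fibre_tower p by exact: tree_tower.
have [cphi [psi [cpsi phiK psiK]]] := hphi.
have [m' m'E] := image_probability m cpsi.
have psi_phi A : psi @^-1` (phi @^-1` A) = A.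
  by rewrite -comp_preimage (_ : phi \o psi = id)//; apply/funext.
pose c l : R := ((\prod_(i < l) tree_index T i)%N%:R)^-1.
have c_gt0 l : 0 < c l.
  rewrite invr_gt0 ltr0n prodn_gt0// => i.
  by rewrite (leq_trans _ (tree_index_ge2 T i)).
have m'c l v : m' (p l @^-1` [set v]) = (c l)%:E.
  by rewrite m'E [X in m X](psi_phi (cylinder v)) hm.
have act_level g l x y : p l x = p l y -> p l (Phi g x) = p l (Phi g y).
  have [a aE _] := hnd g => xy; rewrite /p !aE.
  exact: (congr1 (@aut_vertex T a l) xy).
have mum' l v : mu (p l @^-1` [set v]) = m' (p l @^-1` [set v]).
  exact: (invariant_level hp act_level hmin hmu c_gt0 m'c).
exists (fun l => tree_level T l), p; split => //; last first.
  move=> U oU [x Ux].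
  have [l lU] := fibre_nbhs hp (open_nbhs_nbhs (conj oU Ux)).
  apply: (@lt_le_trans _ _ (mu (p l @^-1` [set p l x]))).
    by rewrite mum' m'c lte_fin.
  apply: le_measure; rewrite ?inE//; first exact: measurable_level.
  exact: open_measurable_borel.
move=> g; have [a aE [alpha [alpha0 _ halpha]]] := hnd g.
have cB := @closed_nondegenerate_fixed_points _ _ Phi hX g.
rewrite (eq_measure_closed hp mum' cB).
have cF := @closed_fixed_points _ _ Phi hX g.
apply: (nonporous_null hp (O := ~` fixed_points Phi g) alpha0).
- exact: cB.
- by apply: open_measurable_borel; exact: closed_openC.
- by apply/seteqP; split => x // [[]].
- move=> l x [gx ngx].
  have := halpha l (path_vertex (phi x) l).
  have cylE : psi @^-1` (p l @^-1` [set p l x]) = cylinder (p l x).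
    exact: (psi_phi (cylinder _)).
  rewrite !m'E cylE.
  rewrite (_ : psi @^-1` _ = [set w | cylinder (path_vertex (phi x) l) w /\
      aut_boundary a w <> w]); last first.
    apply/seteqP; split => w [/= xw aw]; split; move: xw; rewrite /p ?psiK//.
      move=> _ aww; apply: aw; rewrite /fixed_points /=.
      by rewrite -[LHS]phiK aE psiK aww.
    by move=> _ gw; apply: aw; rewrite -[in RHS](psiK w) -gw aE psiK.
  apply.
  + by rewrite -{2}gx aE.
  (* If [a] were trivial on the cylinder, [g] would fix a neighbourhood of [x]. *)
  + move=> a1; apply: ngx; rewrite /interior.
    have : nbhs x (p l @^-1` [set p l x]).
      by apply: open_nbhs_nbhs; split => //; exact: fibre_open.
    apply: filterS => y /= yx; apply: (can_inj phiK); rewrite aE a1//.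
    by rewrite inE.
Qed.

(** * Full measure of the points with trivial holonomy *)

Section stabilizer_measurable.
Variables (X : ptopologicalType) (G : groupType) (Phi : action G X).
Variables (e : nat -> G) (eT : forall g, exists n, e n = g).
Hypothesis hX : hausdorff_space X.

Lemma measurable_fixed_points g :
  measurable (fixed_points Phi g : set (borel X)).
Proof. by apply: closed_measurable_borel; exact: closed_fixed_points. Qed.

(** The preimage of a basic open set is a finite intersection of fixed-point sets and complements of
    such sets. *)
Lemma measurable_stab :
  measurable_fun setT (stab Phi : borel X -> borel (subgroup G)).
Proof.
apply: (measurability (rT := borel (subgroup G)) (@open (subgroup G))) => //.
move=> _ [U oU <-]; rewrite setTI.
have [D ->] := open_subgroup_countable eT oU.
rewrite preimage_bigcup bigcup_mkcond.
apply: countable_bigcupT_measurable => // -[s t]; case: ifPn => // _.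
rewrite (_ : _ @^-1` _ =
  (\big[setI/setT]_(n <- s) (fixed_points Phi (e n) : set (borel X))) `&`
  (\big[setI/setT]_(n <- t) ~` (fixed_points Phi (e n) : set (borel X)))).
  apply: measurableI; apply: bigsetI_measurable => n _.
    exact: measurable_fixed_points.
  by apply: measurableC; exact: measurable_fixed_points.
by rewrite -!bigcap_seq; apply/seteqP; split => x [].
Qed.

End stabilizer_measurable.

Section holonomy.
Variables (R : realType) (X : ptopologicalType) (G : groupType).
Variables (Phi : action G X) (mu : probability (borel X) R).
Variables (e : nat -> G) (eT : forall g, exists n, e n = g).
Variables (V : nat -> finType) (p : forall l, X -> V l).
Hypotheses (hX : hausdorff_space X) (hp : fibre_tower p).
Hypothesis hnull : forall g, mu (nondegenerate_fixed_points Phi g) = 0%E.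
Let X0 : set (borel X) := trivial_holonomy Phi.

Lemma measurable_trivial_holonomy : measurable X0.
Proof.
rewrite -[X0]setCK nontrivial_holonomyE.
have -> : \bigcup_g nondegenerate_fixed_points Phi g =
    \bigcup_n nondegenerate_fixed_points Phi (e n).
  apply/seteqP; split => [x [g _ gx]|x [n _ nx]]; last by exists (e n).
  by have [n en] := eT g; exists n; rewrite ?en.
apply: measurableC; apply: bigcup_measurable => n _.
  by apply: closed_measurable_borel; exact: closed_nondegenerate_fixed_points.
Qed.

(** An open set of mass at most [d / 2 ^ (n + 1)] is removed around the closed null set attached to
    [e n]; the removed masses sum to at most [d]. *)
Lemma trivial_holonomy_inner (d : R) : 0 < d ->
  exists K : set X, [/\ closed K, K `<=` X0 & (mu (~` K) <= d%:E)%E].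
Proof.
move=> d0.
have /choice[U hU] n : exists U : set X, [/\ open U,
    nondegenerate_fixed_points Phi (e n) `<=` U &
    (mu U <= (d / (2 ^ n.+1)%:R)%:E)%E].
  apply: (null_closed_outer hp) => //.
    by rewrite divr_gt0// ltr0n expn_gt0.
  exact: closed_nondegenerate_fixed_points.
exists (~` \bigcup_n U n); split.
- by apply: open_closedC; apply: bigcup_open => n _; have [] := hU n.
- rewrite -[X0]setCK nontrivial_holonomyE; apply: subsetC => x [g _ gx].
  have [n en] := eT g; exists n => //.
  by have [_ + _] := hU n; apply; rewrite en.
- have mU n : measurable (U n : set (borel X)).
    by apply: open_measurable_borel; have [] := hU n.
  rewrite setCK (le_trans (generalized_Boole_inequality mu mU _))//.
    exact: bigcup_measurable.
  apply: le_trans (epsilon_trick0 xpredT (ltW d0)).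
  by apply: lee_nneseries => // n _; have [] := hU n.
Qed.

Lemma nontrivial_holonomy_null : mu (~` X0) = 0%E.
Proof.
apply/eqP; rewrite -measure_le0; apply/lee_addgt0Pr => d d0; rewrite add0e.
have [K [cK KX0 /(le_trans _)]] := trivial_holonomy_inner d0; apply.
apply: le_measure; rewrite ?inE; last exact: subsetC.
- by apply: measurableC; exact: measurable_trivial_holonomy.
- by apply: measurableC; exact: closed_measurable_borel.
Qed.

End holonomy.

(** * Quasi-analyticity and atoms *)

Section compatible_metric_lemmas.
Variables (R : realType) (X : topologicalType) (D : X -> X -> R).
Hypothesis hD : compatible_metric D.

Lemma open_metric_ball x (r : R) : open [set y | D x y < r].
Proof.
have [_ _ _ Dtri Dopen] := hD; apply/Dopen => y /= xy.
exists (r - D x y); first by rewrite subr_gt0.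
by move=> z /=; rewrite ltrBrDl; apply: le_lt_trans.
Qed.

Lemma nbhs_metric_ball x (U : set X) : nbhs x U ->
  exists2 r : R, 0 < r & [set y | D x y < r] `<=` U.
Proof.
have [_ _ _ _ Dopen] := hD; rewrite nbhsE => -[W [/Dopen oW Wx] WU].
by have [r r0 rW] := oW _ Wx; exists r => //; exact: subset_trans WU.
Qed.

Lemma diam_metric_ball x (r : R) :
  (diam D [set y | (D x y < r)%R] <= (r *+ 2)%:E)%E.
Proof.
have [_ _ Dsym Dtri _] := hD.
apply: ge_ereal_sup => _ [[y z] [/= xy xz] <-].
rewrite lee_fin (le_trans (Dtri y x z))// mulr2n lerD ?ltW//.
by rewrite Dsym.
Qed.

Lemma le_diam (U : set X) (r : R) x y : (diam D U < r%:E)%E ->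
  U x -> U y -> D x y < r.
Proof.
move=> Ur Ux Uy; rewrite -lte_fin; apply: le_lt_trans Ur.
by apply: ereal_sup_ubound; exists (x, y).
Qed.

Lemma lebesgue_number (I : Type) (W : I -> set X) : compact [set: X] ->
  (forall i, open (W i)) -> (forall x, exists i, W i x) ->
  exists2 r : R, 0 < r & forall U x, (diam D U < r%:E)%E -> U x ->
    exists i, U `<=` W i.
Proof.
move=> /compact_near_coveringP cX oW covW.
have [_ _ _ Dtri _] := hD.
have : \forall r \near 0^'+, [set: X] `<=`
    [set x | exists i, [set y | D x y < r] `<=` W i].
  apply: (cX R (0 : R)^'+
    (fun r x => exists i, [set y | D x y < r] `<=` W i)) => x _.
  have [i Wx] := covW x.
  have [r r0 rW] := nbhs_metric_ball (open_nbhs_nbhs (conj (oW i) Wx)).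
  (* Half of [r] pays for moving the centre from [x] to [x'], the other half for the ball about
     [x']. *)
  have r20 : 0 < r / 2 by rewrite divr_gt0.
  near=> x' s; exists i => y /= x'y; apply: rW => /=.
  rewrite (le_lt_trans (Dtri x x' y))// [r]splitr ltrD//.
    near: x'; apply: open_nbhs_nbhs; split; first exact: open_metric_ball.
    by rewrite /=; have [_ /(_ x x)[_ ->//]] := hD.
  rewrite (lt_trans x'y)//; near: s; exact: nbhs_right_lt.
move=> hr.
near (0 : R)^'+ => r.
exists r => // U x Ur Ux.
have rW : [set: X] `<=` [set x | exists i, [set y | D x y < r] `<=` W i].
  by near: r.
have [i iW] := rW x Logic.I; exists i => y Uy; apply: iW.
exact: le_diam Ux Uy.
Unshelve. all: by end_near.
Qed.

End compatible_metric_lemmas.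

Lemma measurable_set1_subgroup (G : groupType) (H : subgroup G) :
  measurable ([set H] : set (borel (subgroup G))).
Proof.
apply: closed_measurable_borel.
by apply: accessible_closed_set1; apply/hausdorff_accessible/subgroup_hausdorff.
Qed.

(** A pigeonhole for density: if the first set is not dense in [W], it misses a non-empty open part
    of [W], where the remaining sets are tried. *)
Lemma somewhere_dense_seq (X : topologicalType) (I : eqType) (A : I -> set X)
    (s : seq I) (W : set X) : open W -> W !=set0 ->
  (forall O, open O -> O !=set0 -> O `<=` W ->
    exists2 i, i \in s & O `&` A i !=set0) ->
  exists i W', [/\ open W', W' !=set0 &
    forall O, open O -> O !=set0 -> O `<=` W' -> O `&` A i !=set0].
Proof.
elim: s W => [|i s IH] W oW W0 hW.
  by have [] := hW W oW W0 (@subset_refl _ W).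
have [iW|] := pselect (forall O, open O -> O !=set0 -> O `<=` W ->
    O `&` A i !=set0).
  by exists i, W.
move=> /existsNP[P /not_implyP[oP /not_implyP[P0 /not_implyP[PW PAi]]]].
apply: (IH P) => // P' oP' P'0 P'P.
have [j] := hW P' oP' P'0 (subset_trans P'P PW).
rewrite inE => /predU1P[->|js] jP'; last by exists j.
by exfalso; apply: PAi; apply: subset_nonempty jP'; exact: setSI.
Qed.

Section quasi_analyticity.
Variables (R : realType) (X : ptopologicalType) (G : groupType).
Variables (Phi : action G X) (D : X -> X -> R) (mu : probability (borel X) R).
Variables (e : nat -> G) (eT : forall g, exists n, e n = g).
Hypotheses (hX : hausdorff_space X) (cX : compact [set: X]).
Hypotheses (hmin : minimal_action Phi) (hmu : invariant_measure Phi mu).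
Hypothesis hD : compatible_metric D.

Let stab_fibre H : set (borel X) := stab Phi @^-1` [set H].

Lemma measurable_stab_fibre H : measurable (stab_fibre H).
Proof.
have := measurable_stab Phi eT hX measurableT (measurable_set1_subgroup H).
by rewrite setTI.
Qed.

Lemma stab_fibre_conj g H :
  mu (stab_fibre (subgroup_conj g H)) = mu (stab_fibre H).
Proof.
rewrite -(@hmu g _ (measurable_stab_fibre (subgroup_conj g H))); congr (mu _).
apply/seteqP; split => x; rewrite /stab_fibre /= stab_act; last by move=> ->.
move=> xH.
apply: subgroup_eq; apply/seteqP; split => k kx.
- have : subgroup_set (subgroup_conj g (stab Phi x)) (g * k * g^-1)%g.
    by exists k.
  by rewrite xH => /subgroup_conjE; rewrite !mulgA mulVg mul1g mulgVK.
- have : subgroup_set (subgroup_conj g H) (g * k * g^-1)%g by exists k.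
  by rewrite -xH => /subgroup_conjE; rewrite !mulgA mulVg mul1g mulgVK.
Qed.

(** The fibres are disjoint, so [(Num.truncn a^-1).+1] of them, which is more than [a^-1], would
    have total mass above [1]. *)
Lemma finite_stab_fibres (a : R) : 0 < a ->
  finite_set [set H | mu (stab_fibre H) = a%:E].
Proof.
move=> a0; apply: contrapT => infS.
have [B [fB BS nB]] : exists B : set (subgroup G), [/\ finite_set B,
    B `<=` [set H | mu (stab_fibre H) = a%:E] &
    ((Num.truncn a^-1).+1 <= size (finmap.enum_fset (fset_set B)))%N].
  have [B BS nB] := infinite_set_fset (Num.truncn a^-1).+1 infS.
  by eexists; split; [exact: finite_fset|exact: BS|rewrite set_fsetK].
have : (mu (\bigcup_(H in B) stab_fibre H) <= 1)%E.
  by apply: probability_le1; apply: fin_bigcup_measurable => // H _;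
    exact: measurable_stab_fibre.
rewrite measure_fin_bigcup//; last 2 first.
- by move=> H K _ _ [x [<- <-]].
- by move=> H _; exact: measurable_stab_fibre.
rewrite (eq_fsbigr (fun=> a%:E)); last by move=> H /set_mem /BS.
rewrite fsumEFin_const// lee_fin; apply/negP; rewrite -ltNge.
rewrite -mulr_natr -ltr_pdivrMl// mulr1 (lt_le_trans (truncnS_gt _))//.
by rewrite ler_nat.
Qed.

Lemma atom_locally_quasi_analytic H :
  mu (stab_fibre H) != 0%E -> locally_quasi_analytic Phi D.
Proof.
move=> H0; pose a := fine (mu (stab_fibre H)).
have aE : mu (stab_fibre H) = a%:E.
  by rewrite fineK// fin_num_measure//; exact: measurable_stab_fibre.
have a0 : 0 < a by rewrite -lte_fin -aE lt0e H0 measure_ge0.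
have /finite_seqP[s sE] := finite_stab_fibres a0.
have [x xH] : stab_fibre H !=set0.
  by apply/set0P; apply: contra H0 => /eqP ->; rewrite measure0.
(* Every non-empty open set meets the orbit of [x], at a point whose stabilizer is a conjugate of
   [H] and so belongs to the finite list [s]. *)
have [K [W [oW W0 KW]]] : exists K W, [/\ open W, W !=set0 &
    forall O, open O -> O !=set0 -> O `<=` W -> O `&` stab_fibre K !=set0].
  apply: (@somewhere_dense_seq X _ stab_fibre s setT openT); first by exists x.
  move=> O oO O0 _; have [y [Oy [g _ gx]]] := hmin x O0 oO.
  exists (subgroup_conj g H); last first.
    exists (Phi g x); split; first by rewrite gx.
    by rewrite /stab_fibre /= stab_act xH.
  have : [set` s] (subgroup_conj g H) by rewrite -sE /= stab_fibre_conj.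
  by [].
(* A point of [V] with stabilizer [K] puts [g] in [K]; if [g] moved a point of [W], the open moved
   part of [W] would also contain a point with stabilizer [K]. *)
have WV V g : open V -> V !=set0 -> V `<=` W ->
    (forall y, V y -> Phi g y = y) -> forall y, W y -> Phi g y = y.
  move=> oV V0 VW gV y Wy; apply: contrapT => gy.
  have [z [Vz /= zK]] := KW V oV V0 VW.
  have Kg : subgroup_set K g by rewrite -zK; exact: gV.
  have oWg : open (W `&` ~` fixed_points Phi g).
    by apply: openI => //; apply: closed_openC; exact: closed_fixed_points.
  have [w [[Ww gw] wK]] := KW _ oWg (ex_intro _ y (conj Wy gy))
    (@subIsetl _ _ _).
  by apply: gw; rewrite /stab_fibre /= in wK; move: Kg; rewrite -wK.
(* The translates of [W] cover [X] because every orbit meets [W]. *)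
have [x'|r r0 hr] := @lebesgue_number R X D hD G (fun g => Phi g @` W) cX
    (fun g => open_act Phi g oW).
  have [y [Wy [g _ gx]]] := hmin x' W0 oW.
  by exists (g^-1)%g, (Phi g x'); [rewrite gx|rewrite actK].
exists r => // U oU Ur V oV [v Vv] VU g1 g2 g12 u /set_mem Uu.
have [k UkW] := hr U v Ur (VU _ Vv).
(* As [U] lies in the translate of [W] by [k], conjugating by [k] brings the comparison of [g1] and
   [g2] into [W]. *)
have := @WV (Phi k^-1%g @` V) (k^-1 * (g2^-1 * g1) * k)%g (open_act Phi _ oV).
have [w Ww <-] := UkW _ Uu => /(_ _ _ _ w Ww) /(congr1 (Phi g2 \o Phi k)) /=.
rewrite !act_mul !actVK => -> //.
- by exists (Phi k^-1%g v), v.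
- by move=> _ [y Vy <-]; have [z Wz <-] := UkW _ (VU _ Vy); rewrite actK.
- move=> _ [y Vy <-]; rewrite !act_mul actVK g12 ?inE// actK//.
Qed.

Hypothesis hnull : mu (~` trivial_holonomy Phi) = 0%E.
Hypothesis hpos : forall U : set X, open U -> U !=set0 -> (0 < mu U)%E.

Lemma locally_quasi_analytic_atom :
  locally_quasi_analytic Phi D -> exists H, mu (stab_fibre H) != 0%E.
Proof.
move=> [eps eps0 hq].
(* The radius [eps / 3] keeps the diameter at most [2 * eps / 3], strictly below [eps]. *)
pose U : set X := [set y | D point y < eps / 3].
have oU : open U by exact: open_metric_ball.
have Ueps : (diam D U < eps%:E)%E.
  rewrite (le_lt_trans (diam_metric_ball hD _ _))// lte_fin mulr2n -mulrDr.
  by lra.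
have Upoint : U point.
  have [_ D0 _ _ _] := hD.
  by rewrite /U /= (_ : D _ _ = 0) ?divr_gt0//; exact/D0.
have mU : (0 < mu U)%E by apply: hpos => //; exists point.
(* By trivial holonomy [g] agrees with [1] on an open set around [y]; quasi-analyticity extends this
   to all of [U]. *)
have fixU y z g : U y -> U z -> trivial_holonomy Phi y ->
    Phi g y = y -> Phi g z = z.
  move=> Uy Uz /trivial_holonomyP y0 /y0 gy.
  rewrite -[RHS](act1 Phi).
  apply: (hq U oU Ueps ((fixed_points Phi g)° `&` U)).
  - by apply: openI => //; exact: open_interior.
  - by exists y.
  - exact: subIsetr.
  - by move=> w /set_mem[/interior_subset gw _]; rewrite act1.
  - by rewrite inE.
have mX0 : measurable (trivial_holonomy Phi : set (borel X)).
  exact: measurable_trivial_holonomy.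
have [z [Uz z0]] : U `&` trivial_holonomy Phi !=set0.
  apply/set0P/eqP => UX0; move: mU; apply/negP; rewrite -leNgt -hnull.
  apply: le_measure; rewrite ?inE.
  - exact: open_measurable_borel.
  - exact: measurableC.
  - by move=> y Uy y0; rewrite -[False]/(set0 y) -UX0.
(* By [fixU] the trivial-holonomy points of [U] all have the stabilizer of [z], so its fibre covers
   [U] up to a null set. *)
exists (stab Phi z); apply/eqP => S0.
move: mU; apply/negP; rewrite -leNgt -S0.
rewrite -(measureU0 (measurable_stab_fibre _) (measurableC mX0) hnull).
apply: le_measure; rewrite ?inE; first exact: open_measurable_borel.
  by apply: measurableU; [exact: measurable_stab_fibre|exact: measurableC].
move=> y Uy; have [y0|y0] := pselect (trivial_holonomy Phi y); [left|by right].
by apply: subgroup_eq; apply/seteqP; split => g; exact: fixU.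
Qed.

End quasi_analyticity.

(** * The stabilizer isomorphism *)

Section stabilizer_image.
Variables (X : ptopologicalType) (G : groupType) (Phi : action G X).
Hypotheses (hX : hausdorff_space X) (cX : compact [set: X]).

(** [C] is compact and the stabilizer map is continuous at its points, so the image is compact in a
    Hausdorff space. *)
Lemma closed_stab_image (C : set X) : closed C -> C `<=` trivial_holonomy Phi ->
  closed (stab Phi @` C).
Proof.
move=> cC C0; apply: compact_closed; first exact: subgroup_hausdorff.
apply: continuous_compact; last exact: subclosed_compact cC cX _.
apply: continuous_in_subspaceT => x /set_mem Cx.
by apply: stab_continuous => //; exact: C0.
Qed.

(* The Lusin-Souslin theorem for the map stab on C: it is injective, so images
   commute with differences, and it sends closed sets to compact sets. *)
Lemma measurable_stab_image (C : set X) (A : set (borel X)) :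
  {in trivial_holonomy Phi &, injective (stab Phi)} ->
  closed C -> C `<=` trivial_holonomy Phi -> measurable A ->
  measurable (stab Phi @` (A `&` C) : set (borel (subgroup G))).
Proof.
move=> St_inj cC C0; pose M : set (set X) := [set A |
  measurable (stab Phi @` (A `&` C) : set (borel (subgroup G)))].
have closedM B : closed B -> M B.
  move=> cB; apply: closed_measurable_borel; apply: closed_stab_image.
    exact: closedI.
  by move=> x [_]; exact: C0.
have MC B : M B -> M (~` B).
  move=> MB; rewrite /M /= (_ : _ @` _ =
      (stab Phi @` (setT `&` C) : set (borel (subgroup G))) `\`
      (stab Phi @` (B `&` C))).
    by apply: measurableD => //; apply: closedM; exact: closedT.
  apply/seteqP; split => [_ [x [nBx Cx] <-]|_ [[x [_ Cx] <-] nx]].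
    split; first by exists x.
    move=> [y [By Cy] yx]; apply: nBx; rewrite -(St_inj _ _ _ _ yx)// inE.
      exact: C0.
    exact: C0.
  by exists x => //; split => // Bx; apply: nx; exists x.
apply: (@smallest_sub _ (sigma_algebra setT) (@open X) M); first split.
- by apply: closedM; exact: closed0.
- by move=> B MB; rewrite setTD; exact: MC.
- move=> F MF; rewrite /M /= setI_bigcupl image_bigcup.
  by apply: bigcup_measurable => n _; exact: MF.
- by move=> U oU; rewrite -[U]setCK; apply: MC; apply: closedM;
  exact: open_closedC.
Qed.

End stabilizer_image.

Theorem theorem1p11 (R : realType) (X : ptopologicalType) (G : groupType)
  (Phi : action G X) (D : X -> X -> R) (mu : probability (borel X) R)
  (hX : cantor_set X) (hG : finitely_generated G)
  (hmin : minimal_action Phi) (hequi : equicontinuous_action Phi R)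
  (hD : compatible_metric D) (hmu : invariant_measure Phi mu)
  (hnd : locally_non_degenerate R Phi) :
  let St : borel X -> borel (subgroup G) := stab Phi in
  let nu : set (borel (subgroup G)) -> \bar R := pushforward mu St in
  let X0 : set X := trivial_holonomy Phi in
  let Z : set (borel (subgroup G)) :=
    @closure (subgroup G) [set stab Phi x | x in X0] in
  [/\ supported_on nu Z,
      ~ locally_quasi_analytic Phi D <-> non_atomic nu &
      ~ locally_quasi_analytic Phi D -> {in X0 &, injective (stab Phi)} ->
        measure_isomorphism [set: borel X] Phi mu Z (@subgroup_conj G) nu St].
Proof.
move=> St nu X0 Z.
have [f hf] := hX.
have hausX := homeomorphism_hausdorff hf cantor_space_hausdorff.
have cX := homeomorphism_compact hf cantor_space_compact.
have [e eT] := finitely_generated_countable hG.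
have [V [p [hp hnull hpos]]] := locally_non_degenerate_null hausX hmin hmu hnd.
have muX0 := nontrivial_holonomy_null eT hausX hp hnull.
have mX0 : measurable (X0 : set (borel X)).
  exact: (measurable_trivial_holonomy Phi eT hausX).
have mSt : measurable_fun setT St by exact: (measurable_stab Phi eT hausX).
have mStI A : measurable A -> measurable (St @^-1` A).
  by move=> mA; have := mSt measurableT A mA; rewrite setTI.
have mZ : measurable Z by apply: closed_measurable_borel; exact: closed_closure.
have X0Z x : X0 x -> Z (stab Phi x).
  by move=> x0; apply: subset_closure; exists x.
split.
(* (1): [St] maps [X0], which has full measure, into [Z]. *)
- rewrite /supported_on /nu /pushforward.
  apply/eqP; rewrite -measure_le0 -[leRHS]muX0; apply: le_measure; rewrite ?inE.
  + by apply: mStI; exact: measurableC.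
  + exact: measurableC.
  + by move=> x nZ /X0Z.
- split=> [nlqa H|na lqa].
  + apply/eqP; apply: contrapT => /negP H0; apply: nlqa.
    exact: (atom_locally_quasi_analytic eT hausX cX hmin hmu hD H0).
  + have [H /eqP] := locally_quasi_analytic_atom eT hausX hD muX0 hpos lqa.
    by apply; exact: na.
move=> _ St_inj.
have /choice[K hK] n : exists K : set X, [/\ closed K, K `<=` X0 &
    (mu (~` K) <= (n.+1%:R^-1)%:E)%E].
  by apply: (trivial_holonomy_inner eT hausX hp hnull).
(* Taking all translates of the sets [K n] makes their union [SX] invariant; it stays a countable
   union since [e] enumerates [G]. *)
pose C (i : G * nat) := Phi i.1 @` K i.2.
pose SX : set (borel X) := \bigcup_n C (e n.1, n.2).
have cC i : closed (C i).
  have [cK _ _] := hK i.2; rewrite /C -[i.1]invgK -act_preimage.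
  by apply: closed_comp => // x _; exact: act_continuous.
have CX0 i : C i `<=` X0.
  move=> _ [x Kx <-]; apply: trivial_holonomy_act.
  by have [_ + _] := hK i.2; apply.
have mSX : measurable SX.
  apply: countable_bigcupT_measurable => // n.
  exact: closed_measurable_borel.
have SX_sub : SX `<=` X0 by move=> x [n _]; exact: CX0.
have SX_inv : invariant_set Phi SX.
  move=> g x [[n k] _ [y Ky <-]]; have [m em] := eT (g * e n)%g.
  by exists (m, k) => //; exists y; rewrite // em act_mul.
have muSXC : mu (~` SX) = 0%E.
  apply/eqP; rewrite -measure_le0; apply/lee_addgt0Pr => d d0; rewrite add0e.
  (* For this index the bound [n.+1%:R^-1] is below [d], and [K n] lies in [SX] as its own translate
     by [1]. *)
  have [cK KX0 muK] := hK (Num.truncn d^-1).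
  apply: (@le_trans _ _ (mu (~` K (Num.truncn d^-1)))).
    apply: le_measure; rewrite ?inE.
    - exact: measurableC.
    - by apply: measurableC; exact: closed_measurable_borel.
    - apply: subsetC => x Kx; have [n en] := eT 1%g.
      exists (n, Num.truncn d^-1) => //; exists x => //=.
      by rewrite en act1.
  apply: (le_trans muK); rewrite lee_fin invf_ple ?posrE//.
  exact/ltW/truncnS_gt.
have muSXI A : measurable A -> mu (SX `&` A) = mu A.
  move=> mA; apply/eqP; rewrite eq_le; apply/andP; split.
    by apply: le_measure; rewrite ?inE//; exact: measurableI.
  rewrite -(measureU0 (measurableI _ _ mSX mA) (measurableC mSX) muSXC).
  apply: le_measure; rewrite ?inE//.
    by apply: measurableU; [exact: measurableI|exact: measurableC].
  by move=> x Ax; have [xS|xS] := pselect (SX x); [left|right].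
have muSX : mu SX = 1%E by rewrite -[SX]setIT muSXI// probability_setT.
(* [A] is cut into countably many pieces, each inside one closed set [C (e n.1, n.2)], where
   [measurable_stab_image] applies. *)
have mSt_image A : measurable A -> A `<=` SX -> measurable (St @` A).
  move=> mA AS; have -> : A = \bigcup_n (A `&` C (e n.1, n.2)).
    by rewrite -setI_bigcupr; apply/esym/setIidPl.
  rewrite image_bigcup; apply: countable_bigcupT_measurable => // n.
  exact: measurable_stab_image.
(* Conjugation is continuous and preserves the stabilizers of points of [X0], hence also their
   closure. *)
have Z_inv : invariant_set (@subgroup_conj G) Z.
  move=> g H ZH B /(@subgroup_conj_continuous G g H) /ZH[_ [[x x0 <-] Bx]].
  exists (stab Phi (Phi g x)); split; last by rewrite stab_act.
  by exists (Phi g x) => //; exact: trivial_holonomy_act.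
split; [by split|by split|].
exists SX, (St @` SX); split; first by split.
- split; first exact: mSt_image.
  + by move=> _ [x /SX_sub /X0Z xZ <-].
  + by move=> g _ [x Sx <-]; exists (Phi g x); [exact: SX_inv|exact: stab_act].
  + apply/eqP; rewrite eq_le; apply/andP; split.
      by apply: probability_le1; apply: mStI; exact: mSt_image.
    rewrite -muSX; apply: le_measure; rewrite ?inE//.
      by apply: mStI; exact: mSt_image.
    by move=> x Sx; exists x.
- split; last exact: mSt_image.
  + split => // x y /set_mem/SX_sub x0 /set_mem/SX_sub y0.
    exact: (St_inj x y (mem_set x0) (mem_set y0)).
  + exact: measurable_funS mSt.
- by move=> A mA _; rewrite muSXI//; exact: mStI.
- by move=> g x _; exact: stab_act.
Qed.
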